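(* Let $n$ be a positive integer and let $D$ be a loopless multigraph on the vertex set of the complete graph $K_n$ with maximum degree $\Delta(D)\le 2\lfloor\frac{n}{6}\rfloor-4$. Then $D$ is realizable in $K_n$.
   Context: Given a simple graph $G$ and a multigraph $D$ (the demand graph) with $V(D)=V(G)$, $D$ is realizable in $G$ if there exist pairwise edge-disjoint paths $P_1,\dots,P_{|E(D)|}$ in $G$ such that $P_i$ joins the two endpoints of the $i$-th edge $e_i$ of $D$, for every $i$ (parallel edges of $D$ count separately). *)

(* Defs.v *)
From mathcomp Require Import all_boot.

Set Implicit Arguments.
Unset Strict Implicit.
Unset Printing Implicit Defensive.

Record sgraph (V : finType) := SGraph {
  adj :> rel V;
  adj_sym : symmetric adj;
  adj_irrefl : irreflexive adj
}.

(* Edges have identities, so two parallel edges are two elements of [edge D].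
   The order of the two endpoints of an edge is arbitrary and plays no role. *)
Record multigraph (V : finType) := MultiGraph {
  edge : finType;
  ends : edge -> V * V
}.

Definition loopless (V : finType) (D : multigraph V) : Prop :=
  forall e : edge D, (ends e).1 != (ends e).2.

(* A loop counts twice. *)
Definition degree (V : finType) (D : multigraph V) (v : V) : nat :=
  #|[set e : edge D | (ends e).1 == v]| + #|[set e : edge D | (ends e).2 == v]|.

Definition max_degree (V : finType) (D : multigraph V) : nat :=
  \max_(v : V) degree D v.

(* [x :: p] is the vertex sequence of a path (no repeated vertex) of [G]
   from [x] to [y]. *)
Definition is_path (V : finType) (G : sgraph V) (x y : V) (p : seq V) : bool :=
  [&& path G x p, last x p == y & uniq (x :: p)].

(* The edges of the path [x :: p], as unordered pairs of consecutive vertices. *)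
Definition path_edges (V : finType) (x : V) (p : seq V) : seq {set V} :=
  pairmap (fun a b : V => [set a; b]) x p.

(* [P e] is the path assigned to [e], without its first vertex [(ends e).1]. *)
Definition realizable (V : finType) (G : sgraph V) (D : multigraph V) : Prop :=
  exists P : edge D -> seq V,
    (forall e : edge D, is_path G (ends e).1 (ends e).2 (P e)) /\
    (forall e f : edge D, e != f ->
       [disjoint path_edges (ends e).1 (P e) & path_edges (ends f).1 (P f)]).

Lemma complete_adj_sym (n : nat) : symmetric (fun x y : 'I_n => x != y).
Proof. by move=> x y; rewrite eq_sym. Qed.

Lemma complete_adj_irrefl (n : nat) : irreflexive (fun x y : 'I_n => x != y).
Proof. by move=> x; rewrite eqxx. Qed.

Definition complete_graph (n : nat) : sgraph 'I_n :=
  SGraph (@complete_adj_sym n) (@complete_adj_irrefl n).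

(* Main.v *)
Require Import Defs.
From mathcomp Require Import all_boot all_order all_algebra.
From mathcomp Require Import all_fingroup.
From mathcomp Require Import zify.

Set Implicit Arguments.
Unset Strict Implicit.
Unset Printing Implicit Defensive.

(* Induction on [n], deleting six vertices at a time while the bound on the degree
   drops by 2. By Petersen's theorem the demands of degree at most [2m] contain a
   2-factor, oriented along a permutation of the vertices. For a triple of vertices,
   colour the edges of a 2-factor properly with these three vertices: an edge [uv]
   of colour [a] is realized as [u a v]. A vertex of the 2-factor misses one of the
   three colours, and through the corresponding vertex [a] it can take over the end
   of a demand at [a]. If the missing colours are evenly distributed, each [a] can
   get rid of all its demands. Two triples, used with two 2-factors, remove degree 4
   from each remaining vertex and bring back 2. A resolved demand is kept as a loop,
   which is never counted in the degrees below. *)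

(** * Hall's theorem *)

Definition nbrs (T S : finType) (r : T -> S -> bool) (X : {set T}) : {set S} :=
  [set y | [exists x in X, r x y]].

Lemma nbrsU (T S : finType) (r : T -> S -> bool) (X Y : {set T}) :
  nbrs r (X :|: Y) = nbrs r X :|: nbrs r Y.
Proof.
apply/setP=> y; rewrite !inE; apply/existsP/orP.
  by case=> x /andP[]; rewrite inE => /orP[] xX rxy; [left | right];
    apply/existsP; exists x; rewrite xX.
by case=> /existsP[x /andP[xX rxy]]; exists x; rewrite inE xX ?orbT.
Qed.

(** The induction of Halmos and Vaughan, stated for subsets [D] and [R] so that it applies to both
    halves of a split. If some nonempty proper [X] is tight, [X] is matched first and the rest of
    [D] is matched outside [nbrs r X]. Otherwise every such set has a spare neighbour, and any
    single pair can be matched and removed. [s0] is a default value. *)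
Lemma hall_sets (T S : finType) (r : T -> S -> bool) (s0 : S) (n : nat)
    (D : {set T}) (R : {set S}) :
  #|D| <= n ->
  (forall X : {set T}, X \subset D -> #|X| <= #|nbrs r X :&: R|) ->
  exists g : T -> S, {in D &, injective g} /\
    {in D, forall x, r x (g x) && (g x \in R)}.
Proof.
elim: n D R => [|n IHn] D R leDn hallD.
  move: leDn; rewrite leqn0 cards_eq0 => /eqP->.
  by exists (fun=> s0); split=> x; rewrite inE.
have [->|[x0 Dx0]] := set_0Vmem D.
  by exists (fun=> s0); split=> x; rewrite inE.
case: (pickP (fun X : {set T} => [&& X \proper D, X != set0 & #|nbrs r X :&: R| <= #|X|])).
  move=> X /and3P[ltXD nzX tightX].
  have sXD := proper_sub ltXD.
  have cX := proper_card ltXD.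
  have X_gt0 : 0 < #|X| by rewrite card_gt0.
  have leX : #|X| <= n by lia.
  have cDX : #|D :\: X| = #|D| - #|X| by rewrite cardsD (setIidPr sXD).
  have [|g1 [inj1 r1]] := IHn X R leX.
    by move=> Y sYX; apply: hallD; apply: subset_trans sXD.
  have [||g2 [inj2 r2]] := IHn (D :\: X) (R :\: nbrs r X).
  - lia.
  - move=> Y sYDX.
    have /subsetDP[sYD dYX] := sYDX.
    have := hallD (Y :|: X); rewrite subUset sYD sXD => /(_ isT).
    rewrite nbrsU cardsU disjoint_setI0 // cards0 subn0 => leYX.
    have : #|(nbrs r Y :|: nbrs r X) :&: R| <=
           #|nbrs r Y :&: (R :\: nbrs r X)| + #|nbrs r X :&: R|.
      apply: leq_trans (leq_card_setU _ _); apply: subset_leq_card.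
      apply/subsetP=> y; rewrite in_setI !in_setU 2!in_setI in_setD.
      by case: (y \in R); case: (y \in nbrs r X); case: (y \in nbrs r Y).
    lia.
  have g1N x : x \in X -> g1 x \in nbrs r X.
    by move=> xX; rewrite inE; apply/existsP; exists x; case/andP: (r1 x xX) => ->; rewrite xX.
  have g2N x : x \in D -> x \notin X -> g2 x \notin nbrs r X.
    move=> xD xX; have := r2 x; rewrite inE xD xX => /(_ isT).
    by case/andP=> _; rewrite inE => /andP[].
  exists (fun x => if x \in X then g1 x else g2 x); split.
    move=> x y xD yD; case: ifPn => xX; case: ifPn => yX e.
    - exact: inj1.
    - by have := g2N y yD yX; rewrite -e g1N.
    - by have := g2N x xD xX; rewrite e g1N.
    - by apply: inj2; rewrite // inE ?xX ?yX.
  move=> x xD; case: ifPn => xX.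
    exact: r1.
  by have := r2 x; rewrite !inE xD xX => /(_ isT)/and3P[-> _ ->].
move=> slack.
have := hallD [set x0]; rewrite sub1set Dx0 cards1 card_gt0 => /(_ isT)/set0Pn[y0].
rewrite !inE => /andP[/existsP[x /andP[/set1P-> rxy]] Ry0].
have [||g [injg rg]] := IHn (D :\ x0) (R :\ y0).
- by have := cardsD1 x0 D; rewrite Dx0; lia.
- move=> Y; rewrite subsetD1 => /andP[sYD Yx0].
  have [->|nzY] := eqVneq Y set0; first by rewrite cards0.
  have ltYD : Y \proper D by apply/properP; split=> //; exists x0.
  have := slack Y; rewrite ltYD nzY /= => /negbT; rewrite -ltnNge => ltY.
  have := cardsD1 y0 (nbrs r Y :&: R).
  suff -> : (nbrs r Y :&: R) :\ y0 = nbrs r Y :&: (R :\ y0) by lia.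
  by apply/setP=> y; rewrite !inE andbCA.
exists (fun x => if x == x0 then y0 else g x); split.
  move=> x1 x2 D1 D2; case: eqP => [->|/eqP n1]; case: eqP => [->|/eqP n2] // e.
  - by have := rg x2; rewrite !inE n2 D2 -e eqxx /= andbF => /(_ isT).
  - by have := rg x1; rewrite !inE n1 D1 e eqxx /= andbF => /(_ isT).
  - by apply: injg => //; rewrite !inE ?n1 ?n2.
move=> x1 D1; case: eqP => [->|/eqP n1]; first by rewrite rxy Ry0.
by have := rg x1; rewrite !inE n1 D1 => /(_ isT)/and3P[-> _ ->].
Qed.

Theorem hall (T S : finType) (r : T -> S -> bool) :
  (forall X : {set T}, #|X| <= #|nbrs r X|) ->
  exists2 g : T -> S, injective g & forall x, r x (g x).
Proof.
move=> hallT.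
case: (pickP (@predT T)) => [x0 _|T0]; last first.
  have noT : T -> False by move=> x; have := T0 x.
  by exists (fun x => False_rect _ (noT x)) => x; case: (noT x).
case: (pickP (@predT S)) => [s0 _|S0]; last first.
  have := hallT [set x0]; rewrite cards1 card_gt0 => /set0Pn[y _].
  by have := S0 y.
have [|g [injg rg]] := @hall_sets _ _ r s0 #|T| setT setT (max_card _).
  by move=> X _; rewrite setIT.
by exists g => [x y|x]; [apply: injg; rewrite inE | case/andP: (rg x (in_setT x))].
Qed.

(** * Balanced three-colourings of the cycles of a permutation *)

Definition upd (V : eqType) (C : Type) (f : V -> C) (u : V) (x : C) : V -> C :=
  fun z => if z == u then x else f z.

Definition nclass (V : finType) (U : {set V}) (c : V -> 'I_3) (i : 'I_3) : nat :=
  #|[set u in U | c u == i]|.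

Lemma nclass_upd (V : finType) (U : {set V}) (c : V -> 'I_3) u x i :
  u \in U -> nclass U (upd c u x) i = (x == i) + nclass (U :\ u) c i.
Proof.
move=> Uu; rewrite /nclass (cardsD1 u) !inE Uu /upd eqxx; congr (_ + _).
by apply: eq_card => z; rewrite !inE; case: (z == u).
Qed.

Lemma uniq3_cover (a b d i : 'I_3) : uniq [:: a; b; d] -> i \in [:: a; b; d].
Proof.
by move: a b d i; do 4!(case=> [[|[|[|?]]] ?] //).
Qed.

Lemma sort3 (n : 'I_3 -> nat) : exists a b d : 'I_3,
  [/\ uniq [:: a; b; d], n a <= n b & n b <= n d].
Proof.
pose r := fun i j => n i <= n j; pose s := sort r (enum 'I_3).
have Us : uniq s by rewrite sort_uniq enum_uniq.
have Ss : sorted r s by apply: sort_sorted => i j; apply: leq_total.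
have : size s = 3 by rewrite size_sort size_enum_ord.
case: s Us Ss => [|a [|b [|d []]]] //= Us /and3P[ab bd _] _.
by exists a, b, d.
Qed.

Lemma uniq3_complete (a : 'I_3) : exists b d, uniq [:: a; b; d].
Proof.
have [x [y [z [U _ _]]]] := sort3 (fun=> 0).
have := uniq3_cover a U; rewrite !inE => /or3P[]/eqP->; [exists y, z|exists x, z|exists x, y].
all: by move: U; rewrite /= !inE !negb_or !andbT => /andP[/andP[]];
  rewrite ?[y == x]eq_sym ?[z == x]eq_sym ?[z == y]eq_sym => -> -> ->.
Qed.

(** Each [a] of [l] is spliced out of its cycle: composing with [tperm a (t a)] fixes [a] and sends
    its predecessor to its successor. *)
Lemma perm_fix_seq (V : finType) (s : {perm V}) (l : seq V) : exists t : {perm V},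
  {in l, forall a, t a = a} /\
  (forall v, v \notin l -> s v \notin l -> t v = s v).
Proof.
elim: l => [|a l [t [fixt ts]]]; first by exists s.
exists (t * tperm a (t a))%g; split=> [b|v].
  rewrite inE permM; have [-> _|ba /= bl] := eqVneq b a; first by rewrite tpermR.
  rewrite (fixt b) // tpermD // eq_sym //; apply: contra ba => /eqP e.
  by apply/eqP/(@perm_inj _ t); rewrite -e fixt.
rewrite !inE !negb_or => /andP[va vl] /andP[sva svl].
rewrite permM (ts v) // tpermD 1?eq_sym // -(ts v) //.
by apply: contra va => /eqP/perm_inj->.
Qed.

Definition balanced (V : finType) (U : {set V}) (c : V -> 'I_3) : Prop :=
  forall i j, nclass U c i <= nclass U c j + 2.

(* On a [s]-cycle inside [U], [q v] is the colour of the edge from [v] to [s v],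
   [p v] that of the edge entering [v], and [c v] is the remaining colour. *)
Definition cycle_colouring (V : finType) (s : {perm V}) (U : {set V})
    (p q c : V -> 'I_3) : Prop :=
  {in U, forall u, uniq [:: p u; q u; c u]} /\
  {in U, forall u, s u != u -> p (s u) = q u}.

(** A fixed point, a 2-cycle and a 4-cycle add [(1,0,0)], [(2,0,0)] and [(2,2,0)] to the class
    sizes; given to the smallest classes first, these increments keep the spread at most 2. *)
Lemma spread_add (n m : 'I_3 -> nat) (a b d : 'I_3) (x y : nat) :
  uniq [:: a; b; d] -> n a <= n b -> n b <= n d -> n d <= n a + 2 ->
  m a = x + n a -> m b = y + n b -> m d = n d -> x <= 2 -> y = 0 \/ y = x ->
  forall i j, m i <= m j + 2.
Proof.
move=> Uabd le_ab le_bd le_da ma mb md lex xy i j.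
move: (uniq3_cover i Uabd) (uniq3_cover j Uabd); rewrite !inE.
move=> hi hj; move: hi hj le_ab le_bd le_da => {Uabd}.
by case/or3P=> /eqP-> /or3P[]/eqP->; rewrite ?ma ?mb ?md;
  move: {ma mb md} (n a) (n b) (n d) => na nb nd; lia.
Qed.

Lemma spread_succ (n m : 'I_3 -> nat) :
  (forall i, m i = (n i).+1) -> (forall i j, n i <= n j + 2) ->
  forall i j, m i <= m j + 2.
Proof. by move=> mn spr i j; rewrite !mn ltnS. Qed.

Lemma uniq3E (a b d : 'I_3) : uniq [:: a; b; d] = [&& a != b, a != d & b != d].
Proof. by rewrite /= !inE negb_or !andbT -andbA. Qed.

(** Induction on the size of [U], for all [s] at once since splicing changes the permutation. A
    cycle of length at most 4 is removed whole: the vertices of a 3-cycle miss each colour once,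
    those of the other short cycles miss colours of the smallest classes. From a longer cycle three
    consecutive vertices are removed, which again miss each colour once. *)
Lemma closed_balanced_colouring (V : finType) n (s : {perm V}) (U : {set V}) :
  #|U| <= n -> {in U, forall u, s u \in U} ->
  exists p q c, cycle_colouring s U p q c /\ balanced U c.
Proof.
have empty t : exists p q c, cycle_colouring t (set0 : {set V}) p q c /\ balanced set0 c.
  exists (fun=> ord0), (fun=> ord0), (fun=> ord0).
  split; first by split=> u; rewrite inE.
  by move=> i j; rewrite /nclass (_ : [set _ in _ | _] = set0) ?cards0 //;
    apply/setP=> z; rewrite !inE.
elim: n s U => [|n IHn] s U; first by rewrite leqn0 cards_eq0 => /eqP->.
have [->|[u1 U1]] := set_0Vmem U; first by [].
move=> leU clU.
pose u2 := s u1; pose u3 := s u2; pose u4 := s u3; pose u5 := s u4.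
have U2 : u2 \in U by apply: clU.
have U3 : u3 \in U by apply: clU.
have U4 : u4 \in U by apply: clU.
have inj_s := @perm_inj _ s.
have cU1 : #|U :\ u1| <= n by have := cardsD1 u1 U; rewrite U1; lia.
have cU2 : #|U :\ u1 :\ u2| <= n by apply: leq_trans cU1; apply/subset_leq_card/subD1set.
have cU3 : #|U :\ u1 :\ u2 :\ u3| <= n by apply: leq_trans cU2; apply/subset_leq_card/subD1set.
have cU4 : #|U :\ u1 :\ u2 :\ u3 :\ u4| <= n.
  by apply: leq_trans cU3; apply/subset_leq_card/subD1set.
have sn z w : z != w -> s z != s w by rewrite (inj_eq inj_s).
have colE (a b d : 'I_3) : uniq [:: a; b; d] ->
    [/\ a == b = false, a == d = false, b == d = false,
        b == a = false & (d == a = false) * (d == b = false)].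
  by rewrite uniq3E => /and3P[/negbTE ab /negbTE ad /negbTE bd]; rewrite ![_ == a]eq_sym [d == b]eq_sym.
have [e2|n2] := eqVneq u2 u1.
  have [|p [q [c [[un lk] bal]]]] := IHn s _ cU1.
    move=> z; rewrite !inE => /andP[zu1 Uz]; rewrite clU // andbT.
    by apply: contra zu1 => /eqP; rewrite -[RHS]e2 => /inj_s->.
  have [a [b [d [Uabd le_ab le_bd]]]] := sort3 (nclass (U :\ u1) c).
  have [ab ad bd ba [da db]] := colE _ _ _ Uabd.
  exists (upd p u1 b), (upd q u1 d), (upd c u1 a); split; last first.
    apply: (spread_add (x := 1) (y := 0) Uabd le_ab le_bd (bal d a));
      rewrite ?nclass_upd // ?eqxx ?(ab, ad, bd, ba, da, db) ?addnA //.
    by left.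
  split=> z Uz; rewrite /upd.
    have [_|zu1] := eqVneq z u1; first by rewrite uniq3E bd ba da.
    by apply: un; rewrite !inE zu1.
  have [->|zu1] := eqVneq z u1; first by rewrite -/u2 e2 eqxx.
  move=> szz; rewrite ifN; first by apply: lk; rewrite // !inE zu1.
  by apply: contra zu1 => /eqP; rewrite -[RHS]e2 => /inj_s->.
have D2 : u2 \in U :\ u1 by rewrite !inE n2.
have [e3|n3] := eqVneq u3 u1.
  have [|p [q [c [[un lk] bal]]]] := IHn s _ cU2.
    move=> z; rewrite !inE => /and3P[zu2 zu1 Uz]; rewrite clU // andbT.
    by rewrite (sn z u1) // -e3 (sn z u2).
  have [a [b [d [Uabd le_ab le_bd]]]] := sort3 (nclass (U :\ u1 :\ u2) c).
  have [ab ad bd ba [da db]] := colE _ _ _ Uabd.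
  exists (upd (upd p u2 b) u1 d), (upd (upd q u2 d) u1 b), (upd (upd c u2 a) u1 a).
  split; last first.
    apply: (spread_add (x := 2) (y := 0) Uabd le_ab le_bd (bal d a));
      rewrite ?nclass_upd // ?eqxx ?(ab, ad, bd, ba, da, db) ?addnA //.
    by left.
  split=> z Uz; rewrite /upd.
    have [_|zu1] := eqVneq z u1; first by rewrite uniq3E db da ba.
    have [_|zu2] := eqVneq z u2; first by rewrite uniq3E bd da ba.
    by apply: un; rewrite !inE zu1 zu2.
  have [->|zu1] := eqVneq z u1; first by rewrite -/u2 (negbTE n2) eqxx.
  have [->|zu2] := eqVneq z u2; first by rewrite -/u3 e3 eqxx.
  have szu1 : s z != u1 by rewrite -e3; apply: sn.
  have szu2 : s z != u2 by apply: sn.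
  by rewrite (negbTE szu1) (negbTE szu2); apply: lk; rewrite !inE zu1 zu2.
have n32 : u3 != u2 by apply: sn.
have D3 : u3 \in U :\ u1 :\ u2 by rewrite !inE n3 n32.
have [e4|n4] := eqVneq u4 u1.
  have [|p [q [c [[un lk] bal]]]] := IHn s _ cU3.
    move=> z; rewrite !inE => /and4P[zu3 zu2 zu1 Uz]; rewrite clU // andbT.
    by rewrite (sn z u2) // (sn z u1) // -e4 (sn z u3).
  have [a [b [d [Uabd _ _]]]] := sort3 (fun=> 0).
  have [ab ad bd ba [da db]] := colE _ _ _ Uabd.
  exists (upd (upd (upd p u3 b) u2 a) u1 d), (upd (upd (upd q u3 d) u2 b) u1 a).
  exists (upd (upd (upd c u3 a) u2 d) u1 b).
  split; last first.
    apply: spread_succ bal => i; rewrite !nclass_upd //.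
    move: (uniq3_cover i Uabd).
    by rewrite !inE => /or3P[]/eqP->; rewrite ?eqxx ?(ab, ad, bd, ba, da, db).
  split=> z Uz; rewrite /upd.
    have [_|zu1] := eqVneq z u1; first by rewrite uniq3E da db ab.
    have [_|zu2] := eqVneq z u2; first by rewrite uniq3E ab ad bd.
    have [_|zu3] := eqVneq z u3; first by rewrite uniq3E bd ba da.
    by apply: un; rewrite !inE zu1 zu2 zu3.
  have [->|zu1] := eqVneq z u1; first by rewrite -/u2 (negbTE n2) eqxx.
  have [->|zu2] := eqVneq z u2; first by rewrite -/u3 (negbTE n3) (negbTE n32) eqxx.
  have [->|zu3] := eqVneq z u3; first by rewrite -/u4 e4 eqxx.
  have szu1 : s z != u1 by rewrite -e4; apply: sn.
  have szu2 : s z != u2 by apply: sn.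
  have szu3 : s z != u3 by apply: sn.
  by rewrite (negbTE szu1) (negbTE szu2) (negbTE szu3); apply: lk; rewrite !inE zu1 zu2 zu3.
have n42 : u4 != u2 by apply: sn.
have n43 : u4 != u3 by apply: sn.
have D4 : u4 \in U :\ u1 :\ u2 :\ u3 by rewrite !inE n4 n42 n43.
have [e5|n5] := eqVneq u5 u1.
  have [|p [q [c [[un lk] bal]]]] := IHn s _ cU4.
    move=> z; rewrite !inE => /and5P[zu4 zu3 zu2 zu1 Uz]; rewrite clU // andbT.
    by rewrite (sn z u3) // (sn z u2) // (sn z u1) // -e5 (sn z u4).
  have [a [b [d [Uabd le_ab le_bd]]]] := sort3 (nclass (U :\ u1 :\ u2 :\ u3 :\ u4) c).
  have [ab ad bd ba [da db]] := colE _ _ _ Uabd.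
  (* Alternating two colours would put all four vertices into one class; the colours [b], [d], [a],
     [d] around the cycle put two into each of [a] and [b]. *)
  exists (upd (upd (upd (upd p u4 a) u3 d) u2 b) u1 d).
  exists (upd (upd (upd (upd q u4 d) u3 a) u2 d) u1 b).
  exists (upd (upd (upd (upd c u4 b) u3 b) u2 a) u1 a).
  split; last first.
    apply: (spread_add (x := 2) (y := 2) Uabd le_ab le_bd (bal d a));
      rewrite ?nclass_upd // ?eqxx ?(ab, ad, bd, ba, da, db) ?addnA //.
    by right.
  split=> z Uz; rewrite /upd.
    have [_|zu1] := eqVneq z u1; first by rewrite uniq3E db da ba.
    have [_|zu2] := eqVneq z u2; first by rewrite uniq3E bd ba da.
    have [_|zu3] := eqVneq z u3; first by rewrite uniq3E da db ab.
    have [_|zu4] := eqVneq z u4; first by rewrite uniq3E ad ab db.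
    by apply: un; rewrite !inE zu1 zu2 zu3 zu4.
  have [->|zu1] := eqVneq z u1; first by rewrite -/u2 (negbTE n2) eqxx.
  have [->|zu2] := eqVneq z u2; first by rewrite -/u3 (negbTE n3) (negbTE n32) eqxx.
  have [->|zu3] := eqVneq z u3.
    by rewrite -/u4 (negbTE n4) (negbTE n42) (negbTE n43) eqxx.
  have [->|zu4] := eqVneq z u4; first by rewrite -/u5 e5 eqxx.
  have szu1 : s z != u1 by rewrite -e5; apply: sn.
  have szu2 : s z != u2 by apply: sn.
  have szu3 : s z != u3 by apply: sn.
  have szu4 : s z != u4 by apply: sn.
  rewrite (negbTE szu1) (negbTE szu2) (negbTE szu3) (negbTE szu4).
  by apply: lk; rewrite !inE zu1 zu2 zu3 zu4.
(* The orbit of [u1] has length at least 5: splice [u1], [u2], [u3] out of it. *)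
pose t := (s * tperm u1 u4)%g.
have tE z : s z != u1 -> z != u3 -> t z = s z.
  by move=> szu1 zu3; rewrite permM tpermD // eq_sym // (inj_eq inj_s).
have tx z : s z = u1 -> t z = u4 by move=> szu1; rewrite permM szu1 tpermL.
have [|p [q [c [[un lk] bal]]]] := IHn t _ cU3.
  move=> z; rewrite !inE => /and4P[zu3 zu2 zu1 Uz].
  have [/tx->|szu1] := eqVneq (s z) u1; first by rewrite n4 n42 n43 U4.
  by rewrite tE // clU // szu1 (sn z u2) // (sn z u1).
(* The edge entering [u4] in [t] is replaced by a path through [u1], [u2], [u3] with colours [p u4],
   [b], [d], [p u4]. The colours at both its ends are unchanged, and the three inner vertices miss
   [d], [p u4], [b]. *)
have [b [d Uabd]] := uniq3_complete (p u4).
have [ab ad bd ba [da db]] := colE _ _ _ Uabd.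
exists (upd (upd (upd p u3 d) u2 b) u1 (p u4)).
exists (upd (upd (upd q u3 (p u4)) u2 d) u1 b).
exists (upd (upd (upd c u3 b) u2 (p u4)) u1 d).
split; last first.
  apply: spread_succ bal => i; rewrite !nclass_upd //.
  move: (uniq3_cover i Uabd).
  by rewrite !inE => /or3P[]/eqP->; rewrite ?eqxx ?(ab, ad, bd, ba, da, db).
split=> z Uz; rewrite /upd.
  have [_|zu1] := eqVneq z u1; first by rewrite uniq3E ab ad bd.
  have [_|zu2] := eqVneq z u2; first by rewrite uniq3E bd ba da.
  have [_|zu3] := eqVneq z u3; first by rewrite uniq3E da db ab.
  by apply: un; rewrite !inE zu1 zu2 zu3.
have [->|zu1] := eqVneq z u1; first by rewrite -/u2 (negbTE n2) eqxx.
have [->|zu2] := eqVneq z u2; first by rewrite -/u3 (negbTE n3) (negbTE n32) eqxx.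
have [->|zu3] := eqVneq z u3.
  by rewrite -/u4 (negbTE n4) (negbTE n42) (negbTE n43).
have szu2 : s z != u2 by apply: sn.
have szu3 : s z != u3 by apply: sn.
have zU : z \in U :\ u1 :\ u2 :\ u3 by rewrite !inE zu1 zu2 zu3.
have [szu1|szu1] := eqVneq (s z) u1.
  have zu4 : z != u4 by apply: contraNneq n5 => zu4; rewrite /u5 -zu4 szu1.
  by move=> _; rewrite -(lk z) // (tx z) // eq_sym.
by rewrite (negbTE szu2) (negbTE szu3) -(tE z) //; apply: lk.
Qed.

(** [U] need not be closed under [s]: the vertices outside it are first spliced out of the cycles,
    which preserves the edges inside [U]. *)
Lemma balanced_colouring (V : finType) (s : {perm V}) (U : {set V}) :
  exists p q c : V -> 'I_3,
    [/\ {in U, forall u, uniq [:: p u; q u; c u]},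
        forall u, u \in U -> s u \in U -> s u != u -> p (s u) = q u
      & balanced U c].
Proof.
have [t [fixt ts]] := perm_fix_seq s (enum (~: U)).
have tU u : u \in U -> s u \in U -> t u = s u.
  by move=> uU suU; apply: ts; rewrite mem_enum inE negbK.
have [|p [q [c [[un lk] bal]]]] := @closed_balanced_colouring _ #|U| t U (leqnn _).
  move=> u uU; apply: contraLR uU => tuU.
  have /perm_inj<- // : t (t u) = t u by apply: fixt; rewrite mem_enum inE.
exists p, q, c; split=> // u uU suU; rewrite -tU //; exact: lk.
Qed.

(** * Petersen's 2-factor theorem *)

Definition incidence (V : finType) (x : V * V) (v : V) : nat := (x.1 == v) + (x.2 == v).

Lemma sum_pred1 (V : finType) (a : V) : \sum_v (a == v) = 1.
Proof.
by rewrite (bigD1 a) //= eqxx big1 ?addn0 // => v /negbTE; rewrite eq_sym => ->.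
Qed.

Lemma sum_incidence (V : finType) (x : V * V) : \sum_v incidence x v = 2.
Proof. by rewrite big_split /= !sum_pred1. Qed.

Lemma sum_incidence_le2 (V : finType) (x : V * V) (X : {set V}) : \sum_(v in X) incidence x v <= 2.
Proof.
by rewrite -(sum_incidence x) [leqRHS](bigID (mem X)) /= leq_addr.
Qed.

(** Two applications of Hall's theorem. The first replaces an Eulerian orientation: it chooses a
    tail for each edge so that every vertex has [m] outgoing and [m] incoming edges. The second
    finds a perfect matching in the resulting bipartite graph from tails to heads, that is, a
    permutation. *)
Lemma regular_2factor (V E : finType) (ends : E -> V * V) (m : nat) :
  0 < m -> (forall v, \sum_e incidence (ends e) v = m.*2) ->
  exists (s : {perm V}) (phi : V -> E), injective phi /\
    forall v, ends (phi v) = (v, s v) \/ ends (phi v) = (s v, v).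
Proof.
move=> m_gt0 reg.
(* Each vertex has [m] copies, and a copy is matched to an edge whose tail the vertex will be. *)
pose r (y : V * 'I_m) e := 0 < incidence (ends e) y.1.
have [Y|eps inj_eps r_eps] := @hall _ _ r.
  pose X := [set y.1 | y in Y].
  have leY : #|Y| <= #|X| * m.
    have -> : #|X| * m = #|setX X [set: 'I_m]| by rewrite cardsX cardsT card_ord.
    apply/subset_leq_card/subsetP => -[v i] Yvi; rewrite !inE andbT.
    by apply/imsetP; exists (v, i).
  suff : #|X| * m.*2 <= #|nbrs r Y| * 2 by lia.
  rewrite -[#|X| * _]sum_nat_const -[#|nbrs r Y| * _]sum_nat_const.
  under eq_bigr => v _ do rewrite -(reg v).
  apply: (@leq_trans (\sum_(v in X) \sum_(e in nbrs r Y) incidence (ends e) v)); last first.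
    by rewrite exchange_big /=; apply: leq_sum => e _; apply: sum_incidence_le2.
  apply: leq_sum => v /imsetP[y Yy ->].
  rewrite (bigID (mem (nbrs r Y))) /= [X in _ + X]big1 ?addn0 // => e.
  rewrite inE negb_exists => /forallP/(_ y); rewrite Yy /= /r -leqNgt.
  by rewrite leqn0 => /eqP.
(* By double counting both sides have equal size, so the matching is bijective and every edge gets a
   tail. *)
have cE : #|E| = #|{: V * 'I_m}|.
  rewrite card_prod card_ord.
  have : \sum_e \sum_v incidence (ends e) v = \sum_v \sum_e incidence (ends e) v.
    exact: exchange_big.
  under eq_bigr => e _ do rewrite sum_incidence.
  under [RHS]eq_bigr => v _ do rewrite reg.
  by rewrite !sum_nat_const !cardT; lia.
have [eps' epsK epsK'] : bijective eps by apply: inj_card_bij; rewrite ?cE.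
pose tl e := (eps' e).1.
pose hd e := if (ends e).1 == tl e then (ends e).2 else (ends e).1.
have endsE e : ends e = (tl e, hd e) \/ ends e = (hd e, tl e).
  have := r_eps (eps' e); rewrite epsK' /r -/(tl e) /incidence /hd.
  case: (ends e) => x y /=; case: eqP => [->|_]; first by left.
  by case: eqP => // ->; right.
have multE e v : incidence (ends e) v = (tl e == v) + (hd e == v).
  by case: (endsE e) => ->; rewrite /incidence //= addnC.
have tl_ge v : m <= \sum_e (tl e == v).
  have -> : \sum_e (tl e == v) = #|[set e | tl e == v]|.
    by rewrite -sum1dep_card [RHS]big_mkcond; apply: eq_bigr => e _; case: eqP.
  have -> : m = #|[set eps (v, i) | i : 'I_m]|.
    by rewrite card_imset ?card_ord // => i j /inj_eps[].
  apply/subset_leq_card/subsetP => _ /imsetP[i _ ->].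
  by rewrite inE /tl epsK.
have hd_le v : \sum_e (hd e == v) <= m.
  have := reg v; under eq_bigr => e _ do rewrite multE.
  by rewrite big_split /=; have := tl_ge v; lia.
pose r2 v w := [exists e, (tl e == v) && (hd e == w)].
have [X|g inj_g r_g] := @hall _ _ r2.
  suff : #|X| * m <= #|nbrs r2 X| * m by rewrite leq_pmul2r.
  rewrite -!sum_nat_const.
  apply: (@leq_trans (\sum_(v in X) \sum_e (tl e == v))); first exact: leq_sum.
  apply: (@leq_trans (\sum_(w in nbrs r2 X) \sum_e (hd e == w))); last exact: leq_sum.
  rewrite exchange_big [leqRHS]exchange_big /=; apply: leq_sum => e _.
  have [tX|tX] := boolP (tl e \in X); last first.
    by rewrite big1 // => v vX; case: eqP => // tv; rewrite -tv (negbTE tX) in vX.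
  have hN : hd e \in nbrs r2 X.
    rewrite inE; apply/existsP; exists (tl e); rewrite tX.
    by apply/existsP; exists e; rewrite !eqxx.
  rewrite [leqRHS](bigD1 (hd e)) //= eqxx; apply: leq_trans (leq_addr _ _).
  rewrite -[leqRHS](sum_pred1 (tl e)) [leqRHS](bigID (mem X)) /= leq_addr //.
pose phi v := xchoose (existsP (r_g v)).
have phiP v : (tl (phi v) == v) && (hd (phi v) == g v).
  exact: (xchooseP (existsP (r_g v))).
exists (perm inj_g), phi; split.
  move=> v w e; have /andP[/eqP<- _] := phiP v.
  by have /andP[/eqP<- _] := phiP w; rewrite e.
move=> v; rewrite permE; have /andP[/eqP tv /eqP hv] := phiP v.
by have := endsE (phi v); rewrite tv hv.
Qed.

(** * Partial 2-factors in demands of bounded degree *)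

Definition inc (V E : finType) (ends : E -> V * V) (v : V) : {set E} :=
  [set e | ((ends e).1 != (ends e).2) && (((ends e).1 == v) || ((ends e).2 == v))].

(** Loops are exempt, since a resolved demand may sit at a deleted vertex. *)
Definition supported (V E : finType) (S : {set V}) (ends : E -> V * V) : Prop :=
  forall e, (ends e).1 != (ends e).2 -> ((ends e).1 \in S) && ((ends e).2 \in S).

Lemma inc_unsupported (V E : finType) (S : {set V}) (ends : E -> V * V) v :
  supported S ends -> v \notin S -> inc ends v = set0.
Proof.
move=> suppS vS; apply/setP=> e; rewrite !inE; apply/negP=> /andP[/suppS/andP[e1 e2]].
by case/orP=> /eqP ev; rewrite -ev ?e1 ?e2 in vS.
Qed.

Definition used (V E : finType) (phi : V -> option E) : {set E} :=
  [set e | [exists v, phi v == Some e]].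

(* [phi v] is the edge from [v] to [s v], if there is one. *)
Definition partial_2factor (V E : finType) (ends : E -> V * V) (s : {perm V})
    (phi : V -> option E) : Prop :=
  (forall v e, phi v = Some e ->
     v != s v /\ (ends e = (v, s v) \/ ends e = (s v, v))) /\
  (forall v w e, phi v = Some e -> phi w = Some e -> v = w).

(** Turns a list of degree deficits into dummy edges, possibly loops. *)
Lemma pair_up (V : eqType) (l : seq V) : ~~ odd (size l) ->
  exists t : seq (V * V),
    (forall v, \sum_(x <- t) ((x.1 == v) + (x.2 == v)) = count_mem v l) /\
    {in t, forall x, x.1 \in l /\ x.2 \in l}.
Proof.
have [n] := ubnP (size l); elim: n l => // n IHn [|a [|b l]] //=.
  by exists [::]; split=> // v; rewrite big_nil.
rewrite negbK => ltl evl; have [|t [tc tm]] := IHn l _ evl; first by lia.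
exists ((a, b) :: t); split=> [v|x].
  by rewrite big_cons tc addnA.
by rewrite !inE => /predU1P[->|/tm[-> ->]]; rewrite /= ?eqxx ?orbT.
Qed.

Lemma sum_inc (V E : finType) (ends : E -> V * V) v :
  \sum_(e in [set e | (ends e).1 != (ends e).2]) incidence (ends e) v = #|inc ends v|.
Proof.
rewrite -sum1dep_card big_mkcondr; apply: eq_big => e; rewrite inE // /incidence => ne.
by case: (eqVneq (ends e).1 v) ne => [->|_]; case: (eqVneq (ends e).2 v) => // ->; rewrite eqxx.
Qed.

(** The demands are padded to a [2m]-regular multigraph with dummy edges, and the dummy edges are
    then dropped from its 2-factor. The deficits inside [S] have even sum, so they can be paired
    up. *)
Lemma exists_2factor (V E : finType) (ends : E -> V * V) (S : {set V}) (m : nat) :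
  supported S ends ->
  (forall v, #|inc ends v| <= m.*2) ->
  exists s phi, [/\ partial_2factor ends s phi,
    forall v, (s v \in S) = (v \in S) &
    forall v, #|inc ends v :\: used phi| <= m.*2 - 2].
Proof.
move=> endsS deg; have [m0|m_gt0] := posnP m.
  exists 1%g, (fun=> None); split=> [|v|v]; rewrite ?perm1 //.
  by rewrite (leq_trans (subset_leq_card (subsetDl _ _))) // (leq_trans (deg v)) // m0.
pose NL := [set e | (ends e).1 != (ends e).2].
have incS v := inc_unsupported (v := v) endsS.
pose f v := m.*2 - #|inc ends v|.
pose l := flatten [seq nseq (f v) v | v <- enum S].
have count_l v : count_mem v l = if v \in S then f v else 0.
  rewrite count_flatten -map_comp sumnE big_map.
  under eq_bigr => w _ do rewrite /= count_nseq /=.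
  rewrite big_enum /=; case: ifPn => vS.
    rewrite (bigD1 v) //= eqxx mul1n big1 ?addn0 // => w /andP[_ /negbTE->].
    by rewrite mul0n.
  by apply: big1 => w wS; case: eqP => // wv; rewrite -wv wS in vS.
have lS v : v \in l -> v \in S.
  by case/flatten_mapP=> w; rewrite mem_enum => wS; rewrite mem_nseq => /andP[_ /eqP->].
have [|t [tc tl]] := @pair_up _ l.
  have -> : size l = \sum_(v in S) f v.
    rewrite /l size_flatten /shape -map_comp sumnE big_map big_enum /=.
    by apply: eq_bigr => v _; rewrite /= size_nseq.
  have : \sum_(v in S) f v + \sum_(v in S) #|inc ends v| = (#|S| * m).*2.
    rewrite -big_split /= doubleMr -sum_nat_const.
    by apply: eq_bigr => v _; rewrite subnK.
  have : \sum_(v in S) #|inc ends v| = #|NL|.*2.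
    transitivity (\sum_v \sum_(e in NL) incidence (ends e) v).
      rewrite [RHS](bigID (mem S)) /= [X in _ = _ + X]big1 ?addn0 => [|v vS].
        by apply: eq_bigr => v _; rewrite sum_inc.
      by rewrite sum_inc incS ?cards0.
    rewrite exchange_big -muln2 -sum_nat_const; apply: eq_bigr => e _.
    exact: sum_incidence.
  lia.
(* Vertices outside [S] get [m] loops each, so no edge joins [S] to its complement and [s] preserves
   [S]. *)
pose t2 := flatten [seq nseq m (v, v) | v <- enum (~: S)].
have t2c v : \sum_(x <- t2) incidence x v = if v \in S then 0 else m.*2.
  rewrite /t2 big_flatten big_map big_enum /=.
  have nseqE w : \sum_(x <- nseq m (w, w)) incidence x v = (w == v) * m.*2.
    by rewrite big_nseq iter_addn_0 /incidence /=; case: eqP => _; lia.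
  under eq_bigr => w _ do rewrite nseqE.
  case: ifPn => vS.
    by rewrite big1 // => w; rewrite inE => wS; case: eqP => // wv; rewrite wv vS in wS.
  rewrite (bigD1 v) ?inE //= eqxx mul1n big1 ?addn0 // => w /andP[_ /negbTE->].
  by rewrite mul0n.
have t2S x : x \in t2 -> x.1 \notin S /\ x.2 \notin S.
  case/flatten_mapP=> w; rewrite mem_enum inE => wS.
  by rewrite mem_nseq => /andP[_ /eqP->].
pose T := ({e in NL} + 'I_(size (t ++ t2)))%type.
pose xends (z : T) := match z with
  | inl e => ends (val e) | inr i => tnth (in_tuple (t ++ t2)) i end.
have xS z : ((xends z).1 \in S) = ((xends z).2 \in S).
  case: z => [[e NLe]|i] /=.
    by have := NLe; rewrite inE => /endsS/andP[-> ->].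
  have := mem_tnth i (in_tuple (t ++ t2)); rewrite mem_cat.
  case/orP=> [/tl[/lS-> /lS->]//|/t2S[xS yS]].
  by rewrite (negbTE xS) (negbTE yS).
have xreg v : \sum_z incidence (xends z) v = m.*2.
  rewrite big_sumType /= -(big_tnth _ _ (t ++ t2) xpredT (fun x => incidence x v)).
  rewrite -(big_sub NL (fun e => incidence (ends e) v)) sum_inc big_cat /= t2c.
  rewrite /incidence tc count_l; case: ifPn => vS; last by rewrite incS ?cards0.
  by rewrite addn0 subnKC.
have [s [phi [inj_phi phiE]]] := regular_2factor m_gt0 xreg.
pose psi v := if phi v is inl e then Some (val e) else None.
have psiE v e : psi v = Some e ->
    [/\ (ends e).1 != (ends e).2, xends (phi v) = ends e & exists e', phi v = inl e' /\ val e' = e].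
  rewrite /psi; case: (phi v) => // -[e' NLe] [<-] /=; split=> //.
    by have := NLe; rewrite inE.
  by eexists.
exists s, psi; split.
- split=> [v e|v w e].
    case/psiE=> ne xe _; have := phiE v; rewrite xe => ee; split=> //.
    by case: ee ne => -> //=; rewrite eq_sym.
  move=> /psiE[_ _ [e1 [phiv <-]]] /psiE[_ _ [e2 [phiw /val_inj e12]]].
  by apply: inj_phi; rewrite phiv phiw e12.
- by move=> v; have := xS (phi v); case: (phiE v) => -> /=.
move=> v; pose R := inc ends v :\: used psi.
pose a := phi v; pose b := phi ((s^-1)%g v).
pose g (z : T) : nat := if z is inl e then val e \in R else false.
have gsum : \sum_z g z = #|R|.
  rewrite big_sumType /= [X in _ + X]big1 // addn0.
  rewrite -(big_sub NL (fun e => (e \in R) : nat)) -sum1_card [RHS]big_mkcond /=.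
  rewrite big_mkcond; apply: eq_bigr => e _; rewrite !inE.
  by case: (_ != _); rewrite ?andbF //=; case: (_ && _).
have ga : g a = 0.
  rewrite /g /a; case E1: (phi v) => [e|//].
  by rewrite !inE; case: existsP => //= -[]; exists v; rewrite /psi E1.
have gb : g b = 0.
  rewrite /g /b; case E1: (phi _) => [e|//].
  by rewrite !inE; case: existsP => //= -[]; exists ((s^-1)%g v); rewrite /psi E1.
(* The edges leaving and entering [v] on the 2-factor, real or dummy, take 2 of the padded degree
   [2m]; if [s v = v] they are the same loop, which counts twice. *)
have ptw z : g z + ((a == z) + (b == z)) <= incidence (xends z) v.
  have [<-|az] := eqVneq a z.
    rewrite ga; have [eab|] := eqVneq b a.
      have vv : s v = v.
        by move/inj_phi: eab => {1}<-; rewrite permKV.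
      by case: (phiE v); rewrite /incidence -/a => -> /=; rewrite vv eqxx.
    by move=> _; case: (phiE v); rewrite /incidence -/a => -> /=; rewrite eqxx; case: (s v == v).
  have [<-|bz] := eqVneq b z.
    by case: (phiE ((s^-1)%g v)); rewrite gb /incidence -/b permKV => -> /=;
      rewrite eqxx; case: ((s^-1)%g v == v).
  rewrite addn0 /g; case: z {az bz} => // e.
  by rewrite /R !inE /incidence /=; do 2!case: (_ == v); rewrite ?andbF //=; case: (_ && _).
have : \sum_z (g z + ((a == z) + (b == z))) <= \sum_z incidence (xends z) v.
  by apply: leq_sum => z _; apply: ptw.
by rewrite xreg !big_split /= gsum !sum_pred1 -/R; lia.
Qed.

(** * Deleting three vertices *)

Definition owned (V E : finType) (S : {set V}) (own : V -> V -> option E) (e : E) : rel V :=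
  [rel x y | [&& x \in S, y \in S & own x y == Some e]].

(* [own] distributes the edges of the complete graph on [S] among the demands;
   the demands may be joined by walks, which contain paths. *)
Definition linked (V E : finType) (S : {set V}) (ends : E -> V * V) : Prop :=
  exists own : V -> V -> option E,
    (forall x y, own x y = own y x) /\
    (forall e, connect (owned S own e) (ends e).1 (ends e).2).

Lemma injection_into (V E : finType) (v0 : V) (D : {set E}) (C : {set V}) :
  #|D| <= #|C| ->
  exists g : E -> V, {in D &, injective g} /\ {in D, forall e, g e \in C}.
Proof.
rewrite !cardE => leDC; exists (fun e => nth v0 (enum C) (index e (enum D))).
have lt e : e \in D -> index e (enum D) < size (enum C).
  by move=> De; apply: leq_trans leDC; rewrite index_mem mem_enum.
split=> [e f De Df /eqP|e De].
  rewrite nth_uniq ?enum_uniq ?lt // => /eqP eq_i.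
  by rewrite -(nth_index e (s := enum D) (x := e)) ?mem_enum // eq_i nth_index ?mem_enum.
by rewrite -mem_enum mem_nth ?lt.
Qed.

(** A class of size at most [d - 1] would leave at most [d + 1] for each other class, hence at most
    [3d + 1] in all. *)
Lemma balanced_nclass_ge (V : finType) (U : {set V}) (c : V -> 'I_3) (d : nat) :
  balanced U c -> 3 * d + 2 <= #|U| -> forall i, d <= nclass U c i.
Proof.
move=> bal leU i.
have : \sum_(j < 3) nclass U c j = #|U|.
  rewrite -[RHS]sum1_card (partition_big c xpredT) //=.
  apply: eq_bigr => j _; rewrite /nclass -sum1_card; apply: eq_bigl => z.
  by rewrite inE.
rewrite (bigD1 i) //=.
have : \sum_(j < 3 | j != i) nclass U c j <= \sum_(j < 3 | j != i) (nclass U c i + 2).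
  by apply: leq_sum => j _; apply: bal.
rewrite sum_nat_cond_const.
have -> : #|[set j : 'I_3 | j != i]| = 2.
  by transitivity #|[set~ i]|; [apply: eq_card => j; rewrite !inE | rewrite cardsC1 card_ord].
move=> le2; move: le2 leU; move: (\sum_(_ | _) _) (nclass _ _ _) #|U|; lia.
Qed.

(* Deletes three vertices [a i]: the edges [phi v] of colour [i] are routed
   through [a i], and the ends at [a i] of its own demands are moved to distinct
   vertices missing colour [i]. A remaining vertex thus loses its edges of the
   2-factor and gains at most one edge; it gains none if its predecessor on the
   2-factor had been deleted earlier. *)
Lemma elimination_step (V E : finType) (S : {set V}) (a : 'I_3 -> V)
    (ends : E -> V * V) (s : {perm V}) (phi : V -> option E) (d : nat) :
  let S' := S :\: [set a i | i : 'I_3] in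
  injective a -> (forall i, a i \in S) ->
  supported S ends -> partial_2factor ends s phi ->
  (forall i, #|inc ends (a i)| <= d) ->
  3 * d + 2 <= #|[set v in S' | (s v \in S') && ((s^-1)%g v \in S')]| ->
  exists ends' : E -> V * V,
    [/\ supported S' ends',
        linked S' ends' -> linked S ends,
        forall e, (ends e).1 \in S' -> (ends e).2 \in S' -> e \notin used phi ->
          ends' e = ends e
      & forall v, v \in S' ->
          #|inc ends' v :\: (inc ends v :\: used phi)| <= ((s^-1)%g v \in S)].
Proof.
move=> S' inj_a aS suppS [phiE inj_phi] dega leU.
set U := [set v in S' | _] in leU.
have [p [q [c [un lk bal]]]] := balanced_colouring s U.
pose A := [set a i | i : 'I_3].
have aA i : a i \in A by apply/imsetP; exists i.
have S'E x : (x \in S') = (x \notin A) && (x \in S) by rewrite inE.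
have aS' i : a i \notin S' by rewrite S'E aA.
have US' v : v \in U -> [/\ v \in S', s v \in S' & (s^-1)%g v \in S'].
  by rewrite inE => /and3P[].
pose C i := [set u in U | c u == i].
have leC i : #|inc ends (a i)| <= #|C i|.
  exact: leq_trans (dega i) (balanced_nclass_ge bal leU i).
have /fin_all_exists[g gP] i := injection_into (a i) (leC i).
(* The colour of the edge [phi v] is read at an end in [U]. Two edges of the 2-factor inside [S']
   can only meet at a vertex of [U], so an edge with no end there may have any colour. *)
pose col v := if v \in U then q v else p (s v).
pose real v e := [&& phi v == Some e, v \in S' & s v \in S'].
have realE v e : real v e -> [/\ phi v = Some e, v \in S', s v \in S', v != s v &
    ends e = (v, s v) \/ ends e = (s v, v)].
  by case/and3P=> /eqP pv vS svS; have [? ?] := phiE _ _ pv.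
have col_in v e : real v e -> s v \in U -> col v = p (s v).
  rewrite /col => /realE[_ _ _ ne _] svU; case: ifP => // vU.
  by rewrite lk // eq_sym.
have no_clash v w e f : real v e -> real w f -> v = s w -> col v <> col w.
  move=> rv rw vw; have [_ vS svS _ _] := realE _ _ rv; have [_ wS _ _ _] := realE _ _ rw.
  have vU : v \in U by rewrite inE vS svS vw permK.
  rewrite (col_in _ _ rw) -vw // /col vU => qp.
  by have := un _ vU; rewrite uniq3E qp eqxx.
have matching v w e f x : real v e -> real w f -> col v = col w ->
    (x == v) || (x == s v) -> (x == w) || (x == s w) -> v = w.
  move=> rv rw cvw; case/orP=> /eqP-> /orP[]/eqP //.
  - by move=> vw; case: (no_clash _ _ _ _ rv rw vw).
  - by move=> wv; case: (no_clash _ _ _ _ rw rv (esym wv)).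
  - exact: perm_inj.
have C_clash v e y : real v e -> y \in C (col v) -> (y == v) || (y == s v) -> False.
  rewrite in_set => rv /andP[yU /eqP cy] /orP[]/eqP yv; have := un _ yU; rewrite uniq3E.
    by rewrite cy /col -yv yU eqxx !andbF.
  by rewrite cy (col_in _ _ rv) -yv // eqxx andbF.
(* If both neighbours of [v] on its cycle are gone, [v] gets rid of the edge
   [phi v] by using it as a path of length one. *)
pose special i := ((s^-1)%g (a i) \in S') && ((s^-1)%g ((s^-1)%g (a i)) \notin S').
pose h i e := if special i && (phi ((s^-1)%g (a i)) == Some e) then (s^-1)%g (a i) else g i e.
have gC i e : e \in inc ends (a i) -> g i e \in C i by case: (gP i) => _; apply.
have CU i v : v \in C i -> v \in U by rewrite inE => /andP[].
have spU i : special i -> (s^-1)%g (a i) \notin U.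
  by move=> _; apply/negP=> /US'[_]; rewrite permKV (negbTE (aS' i)).
have hS' i e : e \in inc ends (a i) -> h i e \in S'.
  rewrite /h => ei; case: ifP => [/andP[/andP[]]//|_].
  by have [] := US' _ (CU _ _ (gC _ _ ei)).
have inj_h i : {in inc ends (a i) &, injective (h i)}.
  move=> e f ei fi; rewrite /h.
  case: ifP => [/andP[sp /eqP pe]|_]; case: ifP => [/andP[sp' /eqP pf]|_].
  - by move=> _; move: pf; rewrite pe => -[].
  - by move=> eq_h; have := spU _ sp; rewrite eq_h (CU i) ?gC.
  - by move=> eq_h; have := spU _ sp'; rewrite -eq_h (CU i) ?gC.
  - by case: (gP i) => + _; apply.
(* The demand [e] uses the edge between [a i] and [y], either as half of the route of a 2-factor
   edge of colour [i] or to move its end from [a i] to [y]. By [owner_inj] no edge is used by two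
   demands. *)
pose owner i y e := [exists v, [&& real v e, col v == i & (y == v) || (y == s v)]]
  || (e \in inc ends (a i)) && (h i e == y).
have owner_mix i y v e f : real v e -> col v = i -> (y == v) || (y == s v) ->
    f \in inc ends (a i) -> h i f = y -> False.
  move=> rv cv yv fi; rewrite /h; case: ifP => [/andP[sp _] hy|_ hy]; last first.
    by apply: (C_clash _ _ _ rv _ yv); rewrite cv -hy gC.
  have [_ vS svS _ _] := realE _ _ rv.
  move: yv; rewrite -hy => /orP[]/eqP yv.
    by move: svS; rewrite -yv permKV (negbTE (aS' i)).
  by case/andP: sp; rewrite yv permK vS.
have owner_inj i y e f : owner i y e -> owner i y f -> e = f.
  case/orP=> [/existsP[v /and3P[rv /eqP cv yv]]|/andP[ei /eqP he]];
  case/orP=> [/existsP[w /and3P[rw /eqP cw yw]]|/andP[fi /eqP hf]].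
  - have vw := matching _ _ _ _ _ rv rw (etrans cv (esym cw)) yv yw.
    by have [pv _ _ _ _] := realE _ _ rv; have [] := realE _ _ rw; rewrite -vw pv => -[].
  - by case: (owner_mix _ _ _ _ _ rv cv yv fi hf).
  - by case: (owner_mix _ _ _ _ _ rw cw yw ei he).
  - by apply: (inj_h i) => //; rewrite he hf.
pose f x y := [pick e | [exists i, (a i == x) && owner i y e]].
have fE i y e : owner i y e -> f (a i) y = Some e.
  move=> oe; rewrite /f; case: pickP => /= [e'|/(_ e)/negbT/negP[]]; last first.
    by apply/existsP; exists i; rewrite eqxx.
  by case/existsP=> j /andP[/eqP/inj_a-> oe']; rewrite (owner_inj _ _ _ _ oe oe').
(* The new place of the end [x] of [e]. *)
pose L x e := if [pick i | a i == x] is Some i then h i e else x.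
have LA i e : L (a i) e = h i e.
  by rewrite /L; case: pickP => [j /eqP/inj_a->//|/(_ i)/=]; rewrite eqxx.
have LN x e : x \notin A -> L x e = x.
  by rewrite /L; case: pickP => [j /eqP<-|//]; rewrite aA.
pose resolved e := ((ends e).1 == (ends e).2) || [exists v, real v e].
pose ends' e := if resolved e then ((ends e).1, (ends e).1)
                else (L (ends e).1 e, L (ends e).2 e).
have incP e x : (ends e).1 != (ends e).2 -> x = (ends e).1 \/ x = (ends e).2 -> e \in inc ends x.
  by rewrite inE => -> [->|->]; rewrite eqxx ?orbT.
exists ends'; split.
- move=> e; rewrite /ends'; case: ifP => [_|]; first by rewrite eqxx.
  case/negbT/norP => ne _ _; have /andP[e1 e2] := suppS _ ne.
  suff LS x : x = (ends e).1 \/ x = (ends e).2 -> L x e \in S'.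
    by rewrite !LS; [|right|left].
  move=> xe; have [/imsetP[i _ xi]|xA] := boolP (x \in A).
    by rewrite xi LA hS' // -xi incP.
  by rewrite LN // S'E xA; case: xe => ->.
(* Edges between deleted and remaining vertices follow [f], those between remaining vertices follow
   [own'], and those inside the triple stay free. *)
- case=> own' [sym' con']; pose own x y :=
    if x \in A then if y \in A then None else f x y
    else if y \in A then f y x else own' x y.
  exists own; split=> [x y|e]; first by rewrite /own; case: (x \in A); case: (y \in A).
  have conA i y : y \in S' -> owner i y e ->
      connect (owned S own e) y (a i) /\ connect (owned S own e) (a i) y.
    rewrite S'E => /andP[yA yS] o_e; split; apply: connect1;
    by rewrite /owned /= aS yS /own aA (negbTE yA) (fE _ _ _ o_e) eqxx.
  have [->|ne] := eqVneq (ends e).1 (ends e).2; first exact: connect0.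
  have [/existsP[v rv]|nr] := boolP [exists v, real v e].
    have [_ vS svS _ ee] := realE _ _ rv.
    have ow y : (y == v) || (y == s v) -> owner (col v) y e.
      by move=> yv; apply/orP; left; apply/existsP; exists v; rewrite rv eqxx yv.
    have [v1 v2] := conA _ _ vS (ow v (introT orP (or_introl (eqxx v)))).
    have [w1 w2] := conA _ _ svS (ow (s v) (introT orP (or_intror (eqxx (s v))))).
    by case: ee => -> /=; [apply: connect_trans v1 w2|apply: connect_trans w1 v2].
  have LC x : x = (ends e).1 \/ x = (ends e).2 ->
      connect (owned S own e) x (L x e) /\ connect (owned S own e) (L x e) x.
    move=> xe; have [/imsetP[i _ xi]|xA] := boolP (x \in A); last first.
      by rewrite LN //; split; apply: connect0.
    have ei : e \in inc ends (a i) by rewrite -xi incP.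
    have [|u1 u2] := conA i _ (hS' _ _ ei); first by rewrite /owner ei eqxx orbT.
    by rewrite xi LA.
  have [c1 _] := LC (ends e).1 (or_introl erefl).
  have [_ c2] := LC (ends e).2 (or_intror erefl).
  apply: connect_trans c1 (connect_trans _ c2).
  have := con' e; rewrite /ends' /resolved (negbTE ne) (negbTE nr) /=.
  apply: connect_sub => x y; rewrite /owned /= !S'E => /and3P[/andP[xA xS] /andP[yA yS] o_e].
  by apply: connect1; rewrite /= xS yS /own (negbTE xA) (negbTE yA).
- move=> e; rewrite !S'E => /andP[e1 _] /andP[e2 _] nu; rewrite /ends'.
  case: ifP => [/orP[/eqP ee|/existsP[v /realE[pv _ _ _ _]]]|_].
  + by rewrite {2}ee; case: (ends e).
  + by case/negP: nu; rewrite inE; apply/existsP; exists v; rewrite pv.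
  + by rewrite !LN //; case: (ends e).
move=> v vS'; set X := (_ :\: _).
(* A gained demand is either one moved from [a (c v)] to [v], or an edge of the 2-factor at [v]
   whose other end is in the triple. The three cases exclude each other, and each determines [e]. If
   both neighbours of [v] are gone, [phi v] is not gained, because [special] has made it a loop. *)
have XE e : e \in X -> [/\ (s^-1)%g v \in S &
    [\/ [/\ v \in U, e \in inc ends (a (c v)) & g (c v) e = v],
        [/\ v \notin U, (s^-1)%g v \in S' & phi v = Some e]
      | [/\ v \notin U, (s^-1)%g v \notin S' & phi ((s^-1)%g v) = Some e]]].
  rewrite in_setD => /andP[nold]; rewrite inE => /andP[ne' xv].
  have nres : ~~ resolved e.
    by apply: contraNN ne'; rewrite /ends' => ->.
  have eE : ends' e = (L (ends e).1 e, L (ends e).2 e) by rewrite /ends' (negbTE nres).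
  rewrite eE /= in ne' xv; have /norP[ne nr] := nres.
  have [x xe Lx] : exists2 x, x = (ends e).1 \/ x = (ends e).2 & L x e = v.
    by case/orP: xv => /eqP xv; [exists (ends e).1; [left|]|exists (ends e).2; [right|]].
  have spec_loop i : special i -> phi v = Some e -> s v = a i -> False.
    move=> sp pv svi; have vi : (s^-1)%g (a i) = v by rewrite -svi permK.
    have hv : h i e = v by rewrite /h sp vi pv eqxx.
    have vA : v \notin A by move: vS'; rewrite S'E => /andP[].
    have [_ [ee|ee]] := phiE _ _ pv; move: ne'; rewrite ee /= svi LA hv LN ?eqxx //.
  have [/imsetP[i _ xi]|xA] := boolP (x \in A).
    have ei : e \in inc ends (a i) by rewrite -xi incP.
    move: Lx; rewrite xi LA /h; case: ifP => [/andP[sp /eqP pe] vi|_ gv].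
      by case: (spec_loop i sp); rewrite -vi ?permKV.
    have := gC _ _ ei; rewrite gv inE => /andP[vU /eqP ci].
    have [_ _] := US' _ vU; rewrite S'E => /andP[_ svS].
    by split=> //; constructor 1; rewrite ci.
  rewrite LN // in Lx; rewrite {x xA}Lx in xe.
  have eu : e \in used phi by apply: contraR nold => eu; rewrite in_setD eu incP.
  move: eu; rewrite inE => /existsP[u /eqP pu].
  have [nu ee] := phiE _ _ pu; have vu : v = u \/ v = s u by case: ee xe => -> /= [] ->; auto.
  have nreal : ~~ ((u \in S') && (s u \in S')).
    by apply: contra nr => uS; apply/existsP; exists u; rewrite /real pu eqxx.
  have [uS suS] : u \in S /\ s u \in S.
    by have /andP[] := suppS _ ne; case: ee => -> /=.
  case: vu => vu; last first.
    have uv : (s^-1)%g v = u by rewrite vu permK.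
    have uS' : u \notin S' by rewrite -vu vS' andbT in nreal.
    rewrite uv uS; split=> //; constructor 3; split=> //.
    by apply/negP=> /US'[_ _]; rewrite uv (negbTE uS').
  rewrite -vu vS' /= in pu nreal suS.
  have [i _ svi] : exists2 i, i \in 'I_3 & s v = a i.
    by move: nreal; rewrite S'E suS andbT negbK => /imsetP[i _ ->]; exists i.
  have vi : (s^-1)%g (a i) = v by rewrite -svi permK.
  have svS : (s^-1)%g v \in S'.
    by apply/negP=> /negP svS; apply: (spec_loop i); rewrite // /special vi vS'.
  split; first by move: svS; rewrite S'E => /andP[].
  constructor 2; split=> //; by apply/negP=> /US'[_ + _]; apply/negP.
have [svS|svS] := boolP ((s^-1)%g v \in S); last first.
  rewrite leqn0 cards_eq0; apply/set0Pn=> -[e /XE[svS' _]].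
  by rewrite svS' in svS.
apply/card_le1_eqP => e e' /XE[_ +] /XE[_ +].
case=> [[vU ei ge]|[vU sS pe]|[vU sS pe]]; case=> [[vU' ei' ge']|[vU' sS' pe']|[vU' sS' pe']];
  try by [rewrite vU in vU' | rewrite vU' in vU | rewrite sS in sS' | rewrite sS' in sS].
- by have [inj_g _] := gP (c v); apply: inj_g; rewrite // ge ge'.
- by move: pe'; rewrite pe => -[].
- by move: pe'; rewrite pe => -[].
Qed.

(** * Induction *)

(** Each demand is realized by the edge joining its ends; two demands with the same ends would give
    a vertex of degree 2. *)
Lemma linked_matching (V E : finType) (S : {set V}) (ends : E -> V * V) :
  supported S ends -> (forall v, #|inc ends v| <= 1) -> linked S ends.
Proof.
move=> suppS deg1.
exists (fun x y => [pick e | ((ends e).1 != (ends e).2) &&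
  ((ends e == (x, y)) || (ends e == (y, x)))]); split.
  by move=> x y; apply: eq_pick => e; rewrite orbC.
move=> e; have [->|ne] := eqVneq (ends e).1 (ends e).2; first exact: connect0.
have /andP[e1 e2] := suppS _ ne; apply: connect1; rewrite /owned /= e1 e2 /=.
case: pickP => [f /andP[nf fe]|/(_ e)]; last by rewrite ne -surjective_pairing eqxx.
apply/eqP; congr Some; apply: (card_le1_eqP (deg1 (ends e).1)); rewrite inE ?ne ?eqxx // nf.
by case/orP: fe => /eqP->; rewrite /= eqxx ?orbT.
Qed.

Lemma triple_enum (V : finType) (X : {set V}) : #|X| = 3 ->
  exists2 a : 'I_3 -> V, injective a & [set a i | i : 'I_3] = X.
Proof.
move=> cX; exists (fun i => enum_val (cast_ord (esym cX) i)).
  by move=> i j /enum_val_inj/cast_ord_inj.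
apply/setP=> x; apply/imsetP/idP=> [[i _ ->]|Xx]; first exact: enum_valP.
exists (cast_ord cX (enum_rank_in Xx x)) => //.
by rewrite cast_ordK enum_rankK_in.
Qed.

Lemma intermediate_subset (V : finType) (X Y : {set V}) (k : nat) :
  X \subset Y -> #|X| <= k <= #|Y| ->
  exists Z : {set V}, [/\ X \subset Z, Z \subset Y & #|Z| = k].
Proof.
have [n] := ubnP (k - #|X|); elim: n X => // n IHn X ltn sXY /andP[leXk lekY].
have [eX|nX] := eqVneq #|X| k; first by exists X.
have : 0 < #|Y :\: X| by rewrite cardsD (setIidPr sXY); lia.
case/card_gt0P=> y; rewrite inE => /andP[yX yY].
have cX : #|y |: X| = #|X|.+1 by rewrite cardsU1 yX.
have [|||Z [sXZ sZY cZ]] := IHn (y |: X).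
- lia.
- by rewrite subUset sub1set yY.
- lia.
by exists Z; split=> //; apply: subset_trans sXZ; apply: subsetUr.
Qed.

(** A remaining vertex that is not interior is a successor or a predecessor of a vertex of [A]. *)
Lemma card_interior (V : finType) (s : {perm V}) (S A : {set V}) (k : nat) :
  (forall v, (s v \in S) = (v \in S)) ->
  #|s @: A :\: A| <= k -> #|(s^-1)%g @: A :\: A| <= k ->
  #|S :\: A| <= #|[set v in S :\: A | (s v \in S :\: A) && ((s^-1)%g v \in S :\: A)]| + k.*2.
Proof.
move=> sS out_le in_le; set U := [set v in _ | _].
suff : #|S :\: A| <= #|U| + (#|s @: A :\: A| + #|(s^-1)%g @: A :\: A|) by lia.
apply: leq_trans (leq_add (leqnn _) (leq_card_setU _ _)).
apply: leq_trans (leq_card_setU _ _); apply/subset_leq_card/subsetP => v.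
rewrite in_setD => /andP[vA vS].
have svS : s v \in S by rewrite sS.
have wS : (s^-1)%g v \in S by rewrite -sS permKV.
rewrite !in_setU [v \in U]inE !in_setD vA vS svS wS /= !andbT.
have [sA|_] := boolP (s v \in A).
  by apply/orP; right; apply/orP; right; apply/imsetP; exists (s v); rewrite ?permK.
have [sA|//] := boolP ((s^-1)%g v \in A).
by rewrite /=; apply/orP; left; apply/imsetP; exists ((s^-1)%g v); rewrite ?permKV.
Qed.

(** Used to split the demands at a vertex outside the second 2-factor into old survivors, edges of
    that 2-factor cut by the first deletion, and demands gained in the first deletion. *)
Lemma setD_cover (E : finType) (I R P Q : {set E}) :
  I :\: Q \subset
    (R :\: P) :|: [set e in R | (e \in P) && (e \notin Q)] :|: (I :\: R).
Proof.
apply/subsetP=> e; rewrite !inE.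
by case: (e \in Q) (e \in R) (e \in P) => [] [] [] //=; case: (e \in I).
Qed.

(* Six deleted vertices cost two 2-factors (degree 4) and bring back at most two
   moved demands at each remaining vertex, so the degree bound drops by 2. *)
Lemma linked_of_degree (V E : finType) (m : nat) (S : {set V}) (ends : E -> V * V) :
  supported S ends -> (forall v, #|inc ends v| <= m.*2) -> 6 * m + 12 <= #|S| ->
  linked S ends.
Proof.
elim: m S ends => [|m IHm] S ends suppS deg leS.
  by apply: linked_matching => // v; apply: leq_trans (deg v) _.
have [s1 [phi1 [fac1 s1S rest1]]] := exists_2factor suppS deg.
have [//|A1 [_ sA1S cA1]] := @intermediate_subset _ set0 S 3 (sub0set _).
  by rewrite cards0; lia.
have [a1 inj_a1 a1E] := triple_enum cA1.
have a1S i : a1 i \in S by apply: (subsetP sA1S); rewrite -a1E imset_f.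
have cS1 : #|S :\: A1| = #|S| - 3 by rewrite cardsD (setIidPr sA1S) cA1.
(* At least [|S| - 9] vertices are interior, and [|S|] is at least [6m + 18]. *)
have leU1 : 3 * m.+1.*2 + 2 <= #|[set v in S :\: A1 | (s1 v \in S :\: A1)
    && ((s1^-1)%g v \in S :\: A1)]|.
  have := @card_interior _ s1 S A1 3 s1S.
  rewrite cS1 -{1}cA1 => /(_ (leq_trans (subset_leq_card (subsetDl _ _)) (leq_imset_card _ _))).
  rewrite -{1}cA1 => /(_ (leq_trans (subset_leq_card (subsetDl _ _)) (leq_imset_card _ _))).
  lia.
rewrite -a1E in leU1.
have [ends' [supp' link' same' deg']] := elimination_step inj_a1 a1S suppS fac1 (fun i => deg _) leU1.
rewrite a1E in supp' link' same' deg'; set S1 := S :\: A1 in supp' link' same' deg' cS1.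
apply: link'.
have deg1 v : #|inc ends' v| <= m.*2.+1.
  have [vS|vS] := boolP (v \in S1); last by rewrite (inc_unsupported supp' vS) cards0.
  rewrite -(cardsID (inc ends v :\: used phi1)).
  have le1 := leq_trans (deg' v vS) (leq_b1 _).
  have le2 := leq_trans (subset_leq_card (subsetIr (inc ends' v) _)) (rest1 v).
  lia.
have [m0|m_gt0] := posnP m.
  by apply: linked_matching => // v; have := deg1 v; rewrite m0.
(* The second 2-factor is taken in the original demands left by the first, of degree at most [2m],
   and not in [ends'], whose degrees can reach [2m + 1]. *)
pose ends1 e := if e \in used phi1 then ((ends e).1, (ends e).1) else ends e.
have ends1E e : (ends1 e).1 != (ends1 e).2 -> e \notin used phi1 /\ ends1 e = ends e.
  by rewrite /ends1; case: ifP; rewrite ?eqxx.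
have inc1 v : inc ends1 v = inc ends v :\: used phi1.
  by apply/setP=> e; rewrite in_setD !inE /ends1 inE; case: ifP; rewrite ?eqxx.
have supp1 : supported S ends1.
  by move=> e ne; have [_ ee] := ends1E _ ne; rewrite ee in ne *; apply: suppS.
have [|s2 [phi2 [[phi2E inj_phi2] s2S rest2]]] := @exists_2factor _ _ ends1 S m supp1.
  by move=> v; rewrite inc1; have := rest1 v; lia.
have phi2P v e : phi2 v = Some e -> [/\ v != s2 v, e \notin used phi1,
    ends e = (v, s2 v) \/ ends e = (s2 v, v) & e \in inc ends v /\ e \in inc ends (s2 v)].
  case/phi2E=> ne ee; have [|nu ee'] := ends1E e.
    by case: ee => ->; rewrite // eq_sym.
  rewrite ee' in ee; split=> //; rewrite !inE.
  by case: ee => ->; rewrite !eqxx ?orbT ?andbT // eq_sym.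

(* Containing the [s2]-predecessors of [A1], [A1 :|: A2] has at most three
   successors and three predecessors outside; moreover no remaining vertex has its
   [s2]-successor in [A1], so the degree drops even where [phi2] was cut. *)
have [||A2 [sPA2 sA2S cA2]] := @intermediate_subset _ ((s2^-1)%g @: A1 :\: A1) S1 3.
- apply/subsetP=> v; rewrite !in_setD => /andP[-> /imsetP[w wA ->]] /=.
  by rewrite -s2S permKV (subsetP sA1S).
- rewrite cS1 (leq_trans (subset_leq_card (subsetDl _ _)) (leq_trans (leq_imset_card _ _) _)) ?cA1 //.
  lia.
have [a2 inj_a2 a2E] := triple_enum cA2.
have a2S i : a2 i \in S1 by apply: (subsetP sA2S); rewrite -a2E imset_f.
pose A := A1 :|: A2.
have preA v : s2 v \in A1 -> v \in A.
  move=> sv; rewrite inE; have [//|vA] := boolP (v \in A1).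
  apply: (subsetP sPA2); rewrite in_setD vA; apply/imsetP; exists (s2 v) => //.
  by rewrite permK.
have S1A : S1 :\: A2 = S :\: A by rewrite /S1 setDDl.
have cA : #|A| = 6.
  rewrite cardsU cA1 cA2 (_ : A1 :&: A2 = set0) ?cards0 //; apply/setP=> v.
  rewrite !inE; apply/negP=> /andP[vA1 /(subsetP sA2S)].
  by rewrite inE vA1.
have sAS : A \subset S by rewrite subUset sA1S (subset_trans sA2S) // subsetDl.
have cSA : #|S :\: A| = #|S| - 6 by rewrite cardsD (setIidPr sAS) cA.
have leU2 : 3 * m.*2.+1 + 2 <= #|[set v in S :\: A | (s2 v \in S :\: A)
    && ((s2^-1)%g v \in S :\: A)]|.
  have := @card_interior _ s2 S A 3 s2S; rewrite cSA => bound.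
  suff [out_le in_le] : #|s2 @: A :\: A| <= 3 /\ #|(s2^-1)%g @: A :\: A| <= 3.
    by have := bound out_le in_le; lia.
  split; rewrite cardsD card_imset ?cA; try exact: perm_inj.
    suff : #|A1| <= #|s2 @: A :&: A| by rewrite cA1; lia.
    apply/subset_leq_card/subsetP=> v vA; rewrite !inE vA andbT.
    by apply/imsetP; exists ((s2^-1)%g v); rewrite ?permKV //; apply: preA; rewrite permKV.
  suff : #|(s2^-1)%g @: A1| <= #|(s2^-1)%g @: A :&: A|.
    by rewrite card_imset ?cA1; [lia | apply: perm_inj].
  apply/subset_leq_card/subsetP=> _ /imsetP[w wA ->]; rewrite inE preA ?permKV // andbT.
  by apply: imset_f; rewrite inE wA.
(* Only the edges that avoid [A1] are kept; their demands are unchanged in [ends']. *)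
pose phi2' v := if (v \in S1) && (s2 v \in S1) then phi2 v else None.
have fac2 : partial_2factor ends' s2 phi2'.
  split=> [v e|v w e]; rewrite /phi2'.
    case: ifP => // /andP[vS svS] /phi2P[ne nu ee _]; split=> //.
    by rewrite same' //; case: ee => ->.
  by case: ifP => // _ pv; case: ifP => // _ pw; apply: inj_phi2 pv pw.
rewrite -S1A -a2E in leU2.
have [ends'' [supp'' link'' _ deg'']] :=
  elimination_step inj_a2 a2S supp' fac2 (fun i => deg1 _) leU2.
rewrite a2E S1A in supp'' link'' deg''.
apply/link''/IHm => //; last by rewrite cSA; lia.
move=> v; have [vS|vS] := boolP (v \in S :\: A); last first.
  by rewrite (inc_unsupported supp'' vS) cards0.
have [vS1 vA] : v \in S1 /\ v \notin A.
  move: vS; rewrite in_setD => /andP[vA vS]; split=> //; rewrite in_setD vS andbT.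
  by apply: contra vA => vA1; rewrite in_setU vA1.
pose R := inc ends v :\: used phi1.
(* The edges of the second 2-factor at [v] that were cut by deleting [A1]. Since the successor of
   [v] is not in [A1], only the one from its predecessor is possible. *)
pose Z := [set e in R | (e \in used phi2) && (e \notin used phi2')].
have leZ : #|Z| <= ((s2^-1)%g v \in A1).
  have ZE e : e \in Z -> (s2^-1)%g v \in A1 /\ phi2 ((s2^-1)%g v) = Some e.
    rewrite inE => /and3P[eR]; rewrite inE => /existsP[u /eqP pu] nu.
    have [ne _ ee _] := phi2P _ _ pu.
    have nuS : ~~ ((u \in S1) && (s2 u \in S1)).
      by apply: contra nu => uS; rewrite inE; apply/existsP; exists u; rewrite /phi2' uS pu.
    have [vu|vu] : v = u \/ v = s2 u.
      move: eR; rewrite in_setD => /andP[_]; rewrite inE => /andP[_].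
      by case: ee => -> /= /orP[]/eqP; auto.
      case/negP: vA; apply: preA; move: nuS; rewrite -vu vS1 /= /S1 in_setD s2S.
      by move: vS1; rewrite in_setD => /andP[_ ->]; rewrite andbT negbK.
    have uE : (s2^-1)%g v = u by rewrite vu permK.
    rewrite uE; split=> //; move: nuS; rewrite -vu vS1 andbT in_setD -s2S -vu.
    by move: vS1; rewrite in_setD => /andP[_ ->]; rewrite andbT negbK.
  have [wA|wA] := boolP ((s2^-1)%g v \in A1); last first.
    rewrite leqn0 cards_eq0; apply/set0Pn=> -[e /ZE[wA' _]].
    by rewrite wA' in wA.
  by apply/card_le1_eqP=> e f /ZE[_ pe] /ZE[_]; rewrite pe => -[].
pose W := inc ends' v :\: used phi2'.
have leW : #|W| <= (m.*2 - 2) + #|Z| + 1.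
  have sub : W \subset (R :\: used phi2) :|: Z :|: (inc ends' v :\: R).
    exact: setD_cover.
  apply: leq_trans (subset_leq_card sub) _.
  apply: leq_trans (leq_card_setU _ _) _; apply: leq_add; last first.
    exact: leq_trans (deg' v vS1) (leq_b1 _).
  apply: leq_trans (leq_card_setU _ _) _; apply: leq_add => //.
  by have := rest2 v; rewrite inc1.
rewrite -(cardsID W); have := deg'' v vS; have := subset_leq_card (subsetIr (inc ends'' v) W).
(* A cut edge and a gain in the second deletion exclude each other, so the new degree is at most
   [(2m - 2) + 1 + 1]. *)
have : ((s2^-1)%g v \in A1) + ((s2^-1)%g v \in S1) <= 1.
  by rewrite in_setD; case: (_ \in A1) => //=; apply: leq_b1.
rewrite -/W; lia.
Qed.

(** * From owned edges to edge-disjoint paths in the complete graph *)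

Lemma uniq_path_neq (V : eqType) (x : V) (p : seq V) :
  uniq (x :: p) -> path (fun x y : V => x != y) x p.
Proof.
elim: p x => //= y p IHp x /andP[xp yp]; rewrite IHp // andbT.
by apply: contra xp => /eqP->; apply: mem_head.
Qed.

Lemma path_edges_owned (V E : finType) (S : {set V}) own (e : E) x p (X : {set V}) :
  path (owned S own e) x p -> X \in path_edges x p ->
  exists y z, X = [set y; z] /\ own y z = Some e.
Proof.
elim: p x => //= y p IHp x /andP[/and3P[_ _ /eqP oe] yp].
by rewrite inE => /predU1P[->|]; [exists x, y | apply: IHp].
Qed.

Lemma set2_inj (V : finType) (x y z w : V) : [set x; y] = [set z; w] ->
  (x = z /\ y = w) \/ (x = w /\ y = z).
Proof.
move=> eX.
have : x \in [set z; w] by rewrite -eX set21.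
have : y \in [set z; w] by rewrite -eX set22.
have : z \in [set x; y] by rewrite eX set21.
have : w \in [set x; y] by rewrite eX set22.
rewrite !in_set2 => /orP[]/eqP w1 /orP[]/eqP z1 /orP[]/eqP y1 /orP[]/eqP x1;
  by subst; auto.
Qed.

(* The bound is over the integers: it is negative for n < 12. *)
Theorem mainTheorem10 (n : nat) (D : multigraph 'I_n) :
  0 < n ->
  loopless D ->
  ((max_degree D)%:Z <= 2 * (n %/ 6)%N%:Z - 4)%R ->
  realizable (complete_graph n) D.
Proof.
move=> _ _ degD.
(* The degree bound is [2m] for [m = n %/ 6 - 2], and [6m + 12] is at most [n]. The subtraction is
   exact, because the hypothesis forces [n %/ 6] to be at least 2. *)
have [|||own [sym con]] := @linked_of_degree _ _ (n %/ 6 - 2) [set: 'I_n] (@ends _ D).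
- by move=> e _; rewrite !inE.
- move=> v; apply: (@leq_trans (max_degree D)); last by lia.
  apply: leq_trans (leq_bigmax v); apply: leq_trans (leq_card_setU _ _).
  by apply/subset_leq_card/subsetP => e; rewrite !inE => /andP[].
- by rewrite cardsT card_ord; lia.
have /fin_all_exists[P PP] (e : edge D) : exists p, path (owned setT own e) (ends e).1 p /\
    is_path (complete_graph n) (ends e).1 (ends e).2 p.
  have /connectP[p0 op0 ->] := con e; case/shortenP: op0 => p op up _.
  by exists p; rewrite /is_path eqxx up uniq_path_neq.
exists P; split=> [e|e f nef]; first by have [] := PP e.
rewrite disjoint_subset; apply/subsetP=> X Xe; rewrite inE; apply/negP=> Xf.
have [oe _] := PP e; have [of_ _] := PP f.
have [x [y [eX oxy]]] := path_edges_owned oe Xe.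
have [z [w [eX' ozw]]] := path_edges_owned of_ Xf.
suff [ef] : Some e = Some f by rewrite ef eqxx in nef.
by rewrite -oxy -ozw; case: (set2_inj (etrans (esym eX) eX')) => -[-> ->].
Qed.
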